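(* Let $\mu < \sqrt{mn}/(r\sqrt{s})$ and let $X = L + S \in \mathrm{LS}_{m,n}(r,s,\mu)$, where $L$ and $S$ are the low-rank and sparse components as in the definition of $\mathrm{LS}_{m,n}(r,s,\mu)$. Then the following hold: (1) $|\langle L, S\rangle| \le \mu \frac{r\sqrt{s}}{\sqrt{mn}} \|L\|_F \|S\|_F$; (2) $\|L\|_F \le \left(1 - \mu^2 \frac{r^2 s}{mn}\right)^{-1/2}\|X\|_F$ and $\|S\|_F \le \left(1 - \mu^2 \frac{r^2 s}{mn}\right)^{-1/2}\|X\|_F$; (3) $\mathrm{LS}_{m,n}(r,s,\mu)$ is a closed set.
   Context: $\|\cdot\|_F$ is the Frobenius norm and $\langle\cdot,\cdot\rangle$ the associated (trace) inner product on $\mathbb{R}^{m\times n}$. $\|S\|_0$ is the number of non-zero entries of $S$. For $\mu\in[1,\sqrt{mn}/r]$, $\mathrm{LS}_{m,n}(r,s,\mu)$ is the set of all matrices $L+S\in\mathbb{R}^{m\times n}$ such that $\mathrm{rank}(L)\le r$, $\|S\|_0\le s$, and $L$ is $\mu$-incoherent: $\max_{i\in[m]}\|U^T e_i\|_2\le\sqrt{\mu r/m}$ and $\max_{i\in[n]}\|V^T f_i\|_2\le\sqrt{\mu r/n}$, where $U\in\mathbb{R}^{m\times r}$, $V\in\mathbb{R}^{n\times r}$ are the first $r$ left and right singular vectors of $L$, and $e_i\in\mathbb{R}^m$, $f_i\in\mathbb{R}^n$ are canonical basis vectors. *)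

(* Defs.v *)
From mathcomp Require Import all_boot all_order all_algebra.
From mathcomp Require Import all_classical all_reals all_analysis.

Set Implicit Arguments.
Unset Strict Implicit.
Unset Printing Implicit Defensive.

Import Order.TTheory GRing.Theory Num.Theory.
Import numFieldNormedType.Exports.

Local Open Scope classical_set_scope.
Local Open Scope ring_scope.

Definition inner_prod (R : realType) (m n : nat) (A B : 'M[R]_(m, n)) : R :=
  \tr (A^T *m B).

Definition frob_norm (R : realType) (m n : nat) (A : 'M[R]_(m, n)) : R :=
  Num.sqrt (inner_prod A A).

Definition l2_norm (R : realType) (n : nat) (x : 'cV[R]_n) : R :=
  Num.sqrt (\sum_i x i 0 ^+ 2).

Definition nnz (R : realType) (m n : nat) (A : 'M[R]_(m, n)) : nat :=
  #|[pred ij : 'I_m * 'I_n | A ij.1 ij.2 != 0]|.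

Definition orthogonal_mx (R : realType) (n : nat) (A : 'M[R]_n) : Prop :=
  A^T *m A = 1%:M.

(* Full singular value decomposition A = P D Q^T, where the rectangular diagonal
   matrix D has nonnegative entries that do not increase down the diagonal. *)
Definition is_svd (R : realType) (m n : nat) (A : 'M[R]_(m, n))
    (P : 'M[R]_m) (D : 'M[R]_(m, n)) (Q : 'M[R]_n) : Prop :=
  [/\ orthogonal_mx P, orthogonal_mx Q & A = P *m D *m Q^T] /\
  [/\ is_diag_mx D,
      forall (i : 'I_m) (j : 'I_n), 0 <= D i j &
      forall (i i' : 'I_m) (j j' : 'I_n),
        i = j :> nat -> i' = j' :> nat -> (i <= i')%N -> D i' j' <= D i j].

Definition first_cols (R : realType) (r n : nat) (hrn : (r <= n)%N)
    (P : 'M[R]_n) : 'M[R]_(n, r) :=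
  colsub (widen_ord hrn) P.

(* Singular vectors are not unique: when rank L < r, the bounds below depend on
   which vectors complete those with nonzero singular value. Incoherence asks
   for some singular value decomposition that satisfies them. *)
Definition incoherent (R : realType) (m n r : nat)
    (hrm : (r <= m)%N) (hrn : (r <= n)%N) (mu : R) (L : 'M[R]_(m, n)) : Prop :=
  exists (P : 'M[R]_m) (D : 'M[R]_(m, n)) (Q : 'M[R]_n),
    let U := first_cols hrm P in
    let V := first_cols hrn Q in
    [/\ is_svd L P D Q,
        forall i : 'I_m,
          l2_norm (U^T *m delta_mx i 0) <= Num.sqrt (mu * r%:R / m%:R) &
        forall i : 'I_n,
          l2_norm (V^T *m delta_mx i 0) <= Num.sqrt (mu * r%:R / n%:R)].

Definition LS_components (R : realType) (m n r s : nat)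
    (hrm : (r <= m)%N) (hrn : (r <= n)%N) (mu : R)
    (L S : 'M[R]_(m, n)) : Prop :=
  [/\ (\rank L <= r)%N, (nnz S <= s)%N & incoherent hrm hrn mu L].

Definition LS (R : realType) (m n r s : nat)
    (hrm : (r <= m)%N) (hrn : (r <= n)%N) (mu : R) : set 'M[R]_(m, n) :=
  [set X | exists L S, LS_components s hrm hrn mu L S /\ X = L + S].

(* Main.v *)
(* Coordinatewise, L i j is a sum over r indices of products of a row of U, a
   singular value at most |L|_F and a row of V, so incoherence and
   Cauchy-Schwarz bound it by mu r / sqrt (m n) * |L|_F; Cauchy-Schwarz on the
   support of S then gives (1). Expanding |L + S|_F^2 and completing the square
   gives (2). By (2), the elements of LS near a given X have bounded components, so
   they lie in the image under (P, D, Q, S) |-> P D Q^T + S of a compact set of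
   factorisations; this image is closed and contained in LS, whence (3). *)
Require Import Defs.
From mathcomp Require Import all_boot all_order all_algebra.
From mathcomp Require Import all_classical all_reals all_analysis.
From mathcomp Require Import ring lra.

Set Implicit Arguments.
Unset Strict Implicit.
Unset Printing Implicit Defensive.

Import Order.TTheory GRing.Theory Num.Theory.
Import numFieldNormedType.Exports.

Local Open Scope classical_set_scope.
Local Open Scope ring_scope.

(** * Cauchy-Schwarz and the Frobenius inner product *)

(** Lagrange's identity: the right side minus the left side is half of the double sum of the squares
    $(a_i b_j - a_j b_i)^2$. *)
Lemma sum_CauchySchwarz (R : realType) (I : finType) (p : pred I) (a b : I -> R) :
  (\sum_(i | p i) a i * b i) ^+ 2
  <= (\sum_(i | p i) a i ^+ 2) * (\sum_(i | p i) b i ^+ 2).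
Proof.
have lagrange : 0 <= \sum_(i | p i) \sum_(j | p j) (a i * b j - a j * b i) ^+ 2.
  by apply: sumr_ge0 => i _; apply: sumr_ge0 => j _; exact: sqr_ge0.
have e1 : \sum_(i | p i) \sum_(j | p j) a i ^+ 2 * b j ^+ 2 =
   (\sum_(i | p i) a i ^+ 2) * (\sum_(i | p i) b i ^+ 2) by rewrite -big_distrlr.
have e2 : \sum_(i | p i) \sum_(j | p j) (a i * b i) * (a j * b j) =
   (\sum_(i | p i) a i * b i) ^+ 2 by rewrite -big_distrlr.
suff : \sum_(i | p i) \sum_(j | p j) (a i * b j - a j * b i) ^+ 2 =
   2 * ((\sum_(i | p i) a i ^+ 2) * (\sum_(i | p i) b i ^+ 2)
   - (\sum_(i | p i) a i * b i) ^+ 2).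
  by move=> e; move: lagrange; rewrite e pmulr_rge0// subr_ge0.
have -> x y : 2 * (x - y) = x + x - 2 * y :> R by ring.
(* In the second of the two copies of the product the summation indices are exchanged, which
   supplies the terms $a_j^2 b_i^2$. *)
rewrite -{1}e1 -{1}e1 -e2 [X in _ = _ + X - _]exchange_big.
rewrite mulr_sumr -big_split -sumrB /=.
apply: eq_bigr => i pi.
rewrite mulr_sumr -big_split -sumrB /=; apply: eq_bigr => j _.
ring.
Qed.

Lemma inner_prodE (R : realType) (m n : nat) (A B : 'M[R]_(m, n)) :
  inner_prod A B = \sum_(ij : 'I_m * 'I_n) A ij.1 ij.2 * B ij.1 ij.2.
Proof.
rewrite /inner_prod /mxtrace (eq_bigr (fun j => \sum_i A i j * B i j)).
  by rewrite exchange_big pair_big.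
by move=> j _; rewrite mxE; apply: eq_bigr => i _; rewrite mxE.
Qed.

Lemma inner_prodC (R : realType) (m n : nat) (A B : 'M[R]_(m, n)) :
  inner_prod A B = inner_prod B A.
Proof. by rewrite !inner_prodE; apply: eq_bigr => ij _; rewrite mulrC. Qed.

Lemma inner_prod_ge0 (R : realType) (m n : nat) (A : 'M[R]_(m, n)) :
  0 <= inner_prod A A.
Proof. by rewrite inner_prodE; apply: sumr_ge0 => ij _; exact: sqr_ge0. Qed.

Lemma frob_norm_ge0 (R : realType) (m n : nat) (A : 'M[R]_(m, n)) :
  0 <= frob_norm A.
Proof. exact: sqrtr_ge0. Qed.

Lemma sqr_frob_norm (R : realType) (m n : nat) (A : 'M[R]_(m, n)) :
  frob_norm A ^+ 2 = inner_prod A A.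
Proof. by rewrite sqr_sqrtr// inner_prod_ge0. Qed.

Lemma entry_le_frob (R : realType) (m n : nat) (A : 'M[R]_(m, n)) i j :
  `|A i j| <= frob_norm A.
Proof.
rewrite -[leLHS]sqrtr_sqr; apply: ler_wsqrtr.
rewrite inner_prodE (bigD1 (i, j))//= expr2 lerDl.
by apply: sumr_ge0 => ij _; exact: sqr_ge0.
Qed.

(** Cyclicity of the trace brings $P^T P$ and $Q^T Q$ together. Applied to a singular value
    decomposition, this bounds every singular value by the Frobenius norm. *)
Lemma frob_norm_orthogonal (R : realType) (m n : nat) (P : 'M[R]_m)
    (D : 'M[R]_(m, n)) (Q : 'M[R]_n) :
  orthogonal_mx P -> orthogonal_mx Q ->
  frob_norm (P *m D *m Q^T) = frob_norm D.
Proof.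
move=> oP oQ; congr Num.sqrt; rewrite /inner_prod !trmx_mul trmxK.
rewrite mxtrace_mulC -!mulmxA. rewrite (mulmxA Q^T) oQ mul1mx mxtrace_mulC.
by rewrite -!mulmxA oP mulmx1 mxtrace_mulC.
Qed.

Lemma sqr_frob_normD (R : realType) (m n : nat) (A B : 'M[R]_(m, n)) :
  frob_norm (A + B) ^+ 2 =
  frob_norm A ^+ 2 + frob_norm B ^+ 2 + 2 * inner_prod A B.
Proof.
rewrite !sqr_frob_norm !inner_prodE mulr_sumr -!big_split /=.
by apply: eq_bigr => ij _; rewrite !mxE; ring.
Qed.

(** * Rank and entries of a singular value decomposition *)

(** Selecting rows and columns is multiplication on either side by submatrices of the identity. *)
Lemma mxrank_mxsub (F : fieldType) m n p q (f : 'I_p -> 'I_m) (g : 'I_q -> 'I_n)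
    (A : 'M[F]_(m, n)) : (\rank (mxsub f g A) <= \rank A)%N.
Proof.
rewrite -[A in mxsub _ _ A]mul1mx mxsub_mul.
apply: leq_trans (mxrankM_maxr _ _) _.
by rewrite -[A in colsub _ A]mulmx1 -mulmx_colsub mxrankM_maxl.
Qed.

(** A nonzero diagonal entry in a row $i \ge r$ would, by monotonicity, make the first $i+1$
    diagonal entries positive, so that the rank would be at least $i+1 > r$. *)
Lemma svd_entry_eq0 (R : realType) (m n r : nat) (A : 'M[R]_(m, n)) P D Q :
  is_svd A P D Q -> (\rank A <= r)%N ->
  forall (i : 'I_m) (j : 'I_n), (r <= i)%N -> D i j = 0.
Proof.
case=> -[oP oQ ->] [/is_diag_mxP Ddiag Dge0 Dmono] + i j ri.
have [ij|/Ddiag//] := eqVneq (i : nat) j.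
(* The orthogonal factors are invertible, so [A] and [D] have equal rank. *)
have uQ : row_free Q^T by rewrite row_free_unit; case: (mulmx1_unit oQ).
have uP : row_full P by rewrite row_full_unit; case: (mulmx1_unit oP).
rewrite mxrankMfree// (eqmxMfull _ uP) => rD.
apply/eqP; apply: contraTT rD => Dij; rewrite -ltnNge.
have Dij_gt0 : 0 < D i j by rewrite lt_def Dij Dge0.
have him : (i.+1 <= m)%N := ltn_ord i.
have hin : (i.+1 <= n)%N by rewrite ij; exact: ltn_ord.
(* These select the leading square block of order $i+1$, whose last diagonal entry is [D i j]. *)
pose f := widen_ord him; pose g := widen_ord hin.
apply: leq_trans (mxrank_mxsub f g D).
suff /mxrank_unit -> : mxsub f g D \in unitmx by rewrite ltnS.
rewrite unitmxE (_ : mxsub f g D = diag_mx (\row_k D (f k) (g k))); last first.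
  apply/matrixP => k l; rewrite !mxE; have [->|kl] := eqVneq k l.
    by rewrite mulr1n.
  by rewrite mulr0n Ddiag.
rewrite det_diag unitfE; apply/prodf_neq0 => k _; rewrite mxE gt_eqF//.
apply: lt_le_trans Dij_gt0 _; apply: Dmono => //=.
by rewrite -ltnS.
Qed.

(** Reduced form of the decomposition: only the first $r$ columns of [P] and [Q], those that
    incoherence constrains, contribute. *)
Lemma svd_entry (R : realType) (m n r : nat) (hrm : (r <= m)%N)
    (hrn : (r <= n)%N) (P : 'M[R]_m) (D : 'M[R]_(m, n)) (Q : 'M[R]_n) i j :
  is_diag_mx D -> (forall (i : 'I_m) (j : 'I_n), (r <= i)%N -> D i j = 0) ->
  (P *m D *m Q^T) i j = \sum_(k < r)
    P i (widen_ord hrm k)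
      * (D (widen_ord hrm k) (widen_ord hrn k) * Q j (widen_ord hrn k)).
Proof.
move=> /is_diag_mxP Ddiag D0.
rewrite -mulmxA mxE (bigID (fun a : 'I_m => (a < r)%N))/= big_ord_narrow.
rewrite [X in _ + X]big1 ?addr0; last first.
  move=> a; rewrite -leqNgt => ra; rewrite mxE big1 ?mulr0// => b _.
  by rewrite D0// mul0r.
apply: eq_bigr => k _; congr (_ * _); rewrite mxE (bigD1 (widen_ord hrn k))//=.
rewrite mxE big1 ?addr0// => b; rewrite -val_eqE eq_sym => kb.
by rewrite Ddiag ?mul0r.
Qed.

(** * Incoherence and the inner product of the components *)

Lemma sqr_l2_norm_first_cols (R : realType) (r n : nat) (hrn : (r <= n)%N)
    (P : 'M[R]_n) (i : 'I_n) :
  l2_norm ((first_cols hrn P)^T *m delta_mx i 0) ^+ 2 =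
  \sum_(k < r) P i (widen_ord hrn k) ^+ 2.
Proof.
rewrite sqr_sqrtr; last by apply: sumr_ge0 => k _; exact: sqr_ge0.
apply: eq_bigr => k _; congr (_ ^+ 2).
rewrite mxE (bigD1 i)//= !mxE !eqxx mulr1.
by rewrite big1 ?addr0// => l li; rewrite !mxE (negbTE li) mulr0.
Qed.

Lemma incoherent_entry_le (R : realType) (m n r : nat) (hrm : (r <= m)%N)
    (hrn : (r <= n)%N) (mu : R) (L : 'M[R]_(m, n)) i j :
  0 <= mu -> (\rank L <= r)%N -> incoherent hrm hrn mu L ->
  L i j ^+ 2 <= mu ^+ 2 * (r%:R ^+ 2 / (m * n)%:R) * frob_norm L ^+ 2.
Proof.
move=> mu0 rL [P [D [Q [svdL /(_ i) Ui /(_ j) Vj]]]].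
have D0 := svd_entry_eq0 svdL rL.
have [[oP oQ LE] [Ddiag Dge0 _]] := svdL.
have mur_ge0 (k : nat) : 0 <= mu * r%:R / k%:R.
  by rewrite divr_ge0 ?mulr_ge0 ?ler0n.
have sqr_bound k (x : 'cV[R]_k) y :
    0 <= y -> l2_norm x <= Num.sqrt y -> l2_norm x ^+ 2 <= y.
  by move=> y0 xy; rewrite -(sqr_sqrtr y0) lerXn2r// nnegrE sqrtr_ge0.
have {}Ui := sqr_bound _ _ _ (mur_ge0 m) Ui.
have {}Vj := sqr_bound _ _ _ (mur_ge0 n) Vj.
rewrite !sqr_l2_norm_first_cols in Ui Vj.
rewrite [in leLHS]LE (svd_entry hrm hrn _ _ _ _ Ddiag D0).
(* The entries of [P] are separated from the products of singular values and entries of [Q]; the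
   singular values are then bounded by $\|L\|_F$. *)
apply: le_trans (sum_CauchySchwarz _ _ _) _.
rewrite natrM [leRHS](_ : _ = mu * r%:R / m%:R *
  (frob_norm L ^+ 2 * (mu * r%:R / n%:R))); last by rewrite invfM; ring.
apply: ler_pM; rewrite ?Ui//; try by apply: sumr_ge0 => k _; exact: sqr_ge0.
apply: (@le_trans _ _ (frob_norm L ^+ 2 *
    \sum_(k < r) Q j (widen_ord hrn k) ^+ 2)); last first.
  by rewrite ler_wpM2l ?Vj// sqr_ge0.
rewrite mulr_sumr; apply: ler_sum => k _; rewrite exprMn ler_wpM2r ?sqr_ge0//.
rewrite lerXn2r ?nnegrE ?Dge0 ?frob_norm_ge0// LE frob_norm_orthogonal//.
exact: le_trans (ler_norm _) (entry_le_frob _ _ _).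
Qed.

Lemma inner_prod_incoherent_sparse (R : realType) (m n r s : nat)
    (hrm : (r <= m)%N) (hrn : (r <= n)%N) (mu : R) (L S : 'M[R]_(m, n)) :
  0 <= mu -> LS_components s hrm hrn mu L S ->
  inner_prod L S ^+ 2 <=
  mu ^+ 2 * (r%:R ^+ 2 * s%:R / (m * n)%:R) * frob_norm L ^+ 2 * frob_norm S ^+ 2.
Proof.
move=> mu0 [rL nS iL].
pose p := [pred ij : 'I_m * 'I_n | S ij.1 ij.2 != 0].
have sum_supp (F : 'I_m * 'I_n -> R) : (forall ij, S ij.1 ij.2 = 0 -> F ij = 0) ->
    \sum_ij F ij = \sum_(ij | p ij) F ij.
  move=> F0; rewrite (bigID p)/= [X in _ + X]big1 ?addr0// => ij.
  by rewrite negbK => /eqP/F0.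
(* Both the inner product and $\|S\|_F^2$ become sums over the support of [S], so that
   Cauchy-Schwarz meets at most $s$ entries of [L]. *)
rewrite (sqr_frob_norm S) !inner_prodE !sum_supp; last 2 first.
- by move=> ij ->; rewrite mulr0.
- by move=> ij ->; rewrite mulr0.
apply: le_trans (sum_CauchySchwarz _ _ _) _.
rewrite ler_wpM2r//; first by apply: sumr_ge0 => ij _; exact: sqr_ge0.
apply: (@le_trans _ _ (\sum_(ij | p ij)
    mu ^+ 2 * (r%:R ^+ 2 / (m * n)%:R) * frob_norm L ^+ 2)).
  by apply: ler_sum => ij _; exact: incoherent_entry_le.
rewrite sumr_const -[leLHS]mulr_natl.
apply: (@le_trans _ _ (s%:R *
    (mu ^+ 2 * (r%:R ^+ 2 / (m * n)%:R) * frob_norm L ^+ 2))).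
  rewrite ler_wpM2r ?ler_nat//; apply: mulr_ge0; last exact: sqr_ge0.
  apply: mulr_ge0; first exact: sqr_ge0.
  by apply: divr_ge0; rewrite ?sqr_ge0 ?ler0n.
by rewrite le_eqVlt; apply/orP; left; apply/eqP; ring.
Qed.

(** * Norm of a summand against the norm of the sum *)

(** With $a = \|A\|_F$ and $b = \|B\|_F$, one has $\|A+B\|_F^2 \ge a^2 + b^2 - 2gab = (1-g^2)a^2 +
    (b-ga)^2$. The bound for [B] comes from exchanging the summands. *)
Lemma frob_norm_decomposition_le (R : realType) (m n : nat) (g : R)
    (A B : 'M[R]_(m, n)) :
  0 <= g -> g ^+ 2 < 1 -> `|inner_prod A B| <= g * frob_norm A * frob_norm B ->
  frob_norm A <= (1 - g ^+ 2) `^ (- (1 / 2)) * frob_norm (A + B).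
Proof.
move=> g0 g1; rewrite ler_norml => /andP[h _].
have c0 : 0 < 1 - g ^+ 2 by rewrite subr_gt0.
(* The power is $1/\sqrt{1-g^2}$, so the claim becomes $\sqrt{1-g^2}\,\|A\|_F \le \|A+B\|_F$, which
   is then squared. *)
rewrite powRN div1r powR12_sqrt ?(ltW c0)// ler_pdivlMl ?sqrtr_gt0//.
rewrite -(@ler_pXn2r _ 2) ?nnegrE ?mulr_ge0 ?sqrtr_ge0//.
rewrite exprMn sqr_sqrtr ?(ltW c0)// sqr_frob_normD.
have := sqr_ge0 (frob_norm B - g * frob_norm A).
nra.
Qed.

(** * Continuous maps and closed conditions *)

(** A neighbourhood of a matrix contains a product of neighbourhoods of its finitely many entries,
    so continuity can be checked entrywise. *)
Lemma continuous_mx (R : realType) (T : topologicalType) (m n : nat)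
    (f : T -> 'M[R]_(m, n)) :
  (forall i j, continuous (fun x => f x i j)) -> continuous f.
Proof.
move=> cf x B [P Pf PB]; rewrite nbhs_filterE /=.
have Pfx : \forall y \near x, forall i, forall j, P i j (f y i j).
  by apply: filter_forall => i; apply: filter_forall => j; exact: cf (Pf i j).
by apply: filterS Pfx => y Py; exact: PB.
Qed.

Lemma continuous_entry (R : realType) (T : topologicalType) (m n : nat)
    (f : T -> 'M[R]_(m, n)) i j :
  continuous f -> continuous (fun x => f x i j).
Proof.
move=> cf x; apply: (@continuous_comp _ _ _ f (fun M => M i j)).
  exact: cf.
exact: coord_continuous.
Qed.

Lemma continuous_sum (R : realType) (T : topologicalType) (I : finType)
    (p : pred I) (F : I -> T -> R) :
  (forall i, continuous (F i)) -> continuous (fun x => \sum_(i | p i) F i x).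
Proof. move=> cF.
have cD : continuous (fun z : R * R => z.1 + z.2) by exact: (@add_continuous R^o).
exact: (continuous_big (P := p) cD (fun i _ => cF i)). Qed.

Lemma continuous_prod (R : realType) (T : topologicalType) (I : finType)
    (p : pred I) (F : I -> T -> R) :
  (forall i, continuous (F i)) -> continuous (fun x => \prod_(i | p i) F i x).
Proof. move=> cF.
exact: (continuous_big (P := p) (@mul_continuous R) (fun i _ => cF i)). Qed.

Lemma continuous_mulmx (R : realType) (T : topologicalType) (m n p : nat)
    (f : T -> 'M[R]_(m, n)) (g : T -> 'M[R]_(n, p)) :
  continuous f -> continuous g -> continuous (fun x => f x *m g x).
Proof.
move=> cf cg; apply: continuous_mx => i j.
under eq_fun do rewrite mxE.
apply: continuous_sum => k x.
by apply: cvgM; apply: continuous_entry.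
Qed.

Lemma continuous_trmx (R : realType) (T : topologicalType) (m n : nat)
    (f : T -> 'M[R]_(m, n)) :
  continuous f -> continuous (fun x => (f x)^T).
Proof.
move=> cf; apply: continuous_mx => i j; under eq_fun do rewrite mxE.
exact: continuous_entry.
Qed.

Lemma continuous_colsub (R : realType) (T : topologicalType) (m n p : nat)
    (h : 'I_p -> 'I_n) (f : T -> 'M[R]_(m, n)) :
  continuous f -> continuous (fun x => colsub h (f x)).
Proof.
move=> cf; apply: continuous_mx => i j; under eq_fun do rewrite mxE.
exact: continuous_entry.
Qed.

Lemma continuous_l2_norm (R : realType) (T : topologicalType) (n : nat)
    (f : T -> 'cV[R]_n) :
  continuous f -> continuous (fun x => l2_norm (f x)).
Proof.
move=> cf x.
apply: (@continuous_comp _ _ _ (fun y => \sum_i f y i 0 ^+ 2) Num.sqrt);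
  last exact: sqrt_continuous.
apply: continuous_sum => i y.
by apply: cvgM; apply: continuous_entry.
Qed.

Lemma continuous_frob_norm (R : realType) (m n : nat) :
  continuous (@frob_norm R m n).
Proof.
move=> A.
apply: (@continuous_comp _ _ _ (fun B => inner_prod B B) Num.sqrt);
  last exact: sqrt_continuous.
apply: continuous_sum => i; apply: continuous_entry.
by apply: continuous_mulmx; [apply: continuous_trmx|] => B; exact: cvg_id.
Qed.

(** The index type may be a proposition, so a premise independent of [x] is handled like a
    quantifier. *)
Lemma closed_forall (T : topologicalType) (I : Type) (A : I -> set T) :
  (forall i, closed (A i)) -> closed [set x | forall i, A i x].
Proof.
move=> cA; rewrite (_ : mkset _ = \bigcap_i A i); first exact: closed_bigI.
by apply/seteqP; split => x /= Ax i => [_|]; exact: Ax.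
Qed.

Lemma closed_eq_fun (R : realType) (T : topologicalType) (f : T -> R) (c : R) :
  continuous f -> closed [set x | f x = c].
Proof.
by move=> cf; apply: (@preimage_closed _ _ f [set y | y = c]) => // x _; exact: cf.
Qed.

Lemma closed_le_fun (R : realType) (T : topologicalType) (f g : T -> R) :
  continuous f -> continuous g -> closed [set x | f x <= g x].
Proof.
move=> cf cg; rewrite (_ : mkset _ = (fun x => f x - g x) @^-1` [set y | y <= 0]).
  apply: preimage_closed; last exact: closed_le.
  by move=> x _; apply: cvgB; [exact: cf|exact: cg].
by apply/seteqP; split => x /=; rewrite subr_le0.
Qed.

(** * Compact boxes and closed matrix constraints *)

(** The box is the image under the continuous map [vec_mx] of a compact product of segments in the
    space of row vectors. *)
Lemma compact_mx_box (R : realType) (m n : nat) (c : R) :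
  compact [set A : 'M[R]_(m, n) | forall i j, `|A i j| <= c].
Proof.
rewrite (_ : mkset _ = vec_mx @`
    [set v : 'rV[R]_(m * n) | forall k, `[- c, c]%classic (v ord0 k)]); last first.
  apply/seteqP; split => [A Ac|_ [v vc <-] i j] /=.
    exists (mxvec A); last exact: mxvecK.
    by move=> k; case/mxvec_indexP: k => i j; rewrite mxvecE in_itv/= -ler_norml.
  by rewrite mxE ler_norml; have := vc (mxvec_index i j); rewrite /= in_itv.
apply: continuous_compact.
  apply: continuous_subspaceT; apply: continuous_mx => i j.
  under eq_fun do rewrite mxE.
  exact: coord_continuous.
apply: (@rV_compact _ _ (fun=> `[- c, c]%classic)) => k.
exact: segment_compact.
Qed.

(* Writes the sparsity bound as polynomial equations, hence closedness. *)
Lemma nnz_leP (R : realType) (m n s : nat) (S : 'M[R]_(m, n)) :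
  (nnz S <= s)%N <-> forall (A : {set 'I_m * 'I_n}), (s < #|A|)%N ->
    \prod_(ij in A) S ij.1 ij.2 = 0.
Proof.
split=> [nS A sA|prod0].
  apply/eqP; apply: contraTT (leq_ltn_trans nS sA) => /prodf_neq0 AS.
  rewrite -leqNgt; apply: subset_leq_card.
  by apply/fintype.subsetP => ij /AS; rewrite inE.
rewrite leqNgt; apply/negP => sS.
suff /eqP : \prod_(ij in [set ij | S ij.1 ij.2 != 0]%SET) S ij.1 ij.2 = 0.
  by apply/negP/prodf_neq0 => ij; rewrite inE.
by apply: prod0; rewrite cardsE.
Qed.

Lemma closed_nnz (R : realType) (m n s : nat) :
  closed [set S : 'M[R]_(m, n) | (nnz S <= s)%N].
Proof.
rewrite (_ : mkset _ = [set S : 'M[R]_(m, n) |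
    forall (A : {set 'I_m * 'I_n}) (h : (s < #|A|)%N),
      \prod_(ij in A) S ij.1 ij.2 = 0]).
  apply: closed_forall => A; apply: closed_forall => _; apply: closed_eq_fun.
  by apply: continuous_prod => ij; exact: coord_continuous.
by apply/seteqP; split => S /= /nnz_leP.
Qed.

(** Each column of an orthogonal matrix is a unit vector. *)
Lemma orthogonal_entry_le1 (R : realType) (n : nat) (P : 'M[R]_n) i j :
  orthogonal_mx P -> `|P i j| <= 1.
Proof.
move=> /matrixP/(_ j j); rewrite !mxE eqxx mulr1n (bigD1 i)//= mxE => Pj.
rewrite -(@ler_pXn2r _ 2) ?nnegrE// expr1n real_normK ?num_real// -Pj lerDl.
by apply: sumr_ge0 => k _; rewrite mxE; exact: sqr_ge0.
Qed.

Lemma closed_orthogonal (R : realType) (T : topologicalType) (n : nat)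
    (f : T -> 'M[R]_n) :
  continuous f -> closed [set x | orthogonal_mx (f x)].
Proof.
move=> cf; rewrite (_ : mkset _ =
    [set x | forall i j, ((f x)^T *m f x) i j = (1%:M : 'M[R]_n) i j]); last first.
  by apply/seteqP; split => x /= => [->//|h]; apply/matrixP.
apply: closed_forall => i; apply: closed_forall => j; apply: closed_eq_fun.
apply: continuous_entry; apply: continuous_mulmx => //; exact: continuous_trmx.
Qed.

(** With the product itself as the decomposed matrix, the factorisation equation is trivial; the
    other clauses are equations and weak inequalities between continuous functions. *)
Lemma closed_svd (R : realType) (T : topologicalType) (m n : nat)
    (P : T -> 'M[R]_m) (D : T -> 'M[R]_(m, n)) (Q : T -> 'M[R]_n) :
  continuous P -> continuous D -> continuous Q ->
  closed [set x | is_svd (P x *m D x *m (Q x)^T) (P x) (D x) (Q x)].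
Proof.
move=> cP cD cQ.
rewrite (_ : mkset _ = [set x | orthogonal_mx (P x)] `&`
  [set x | orthogonal_mx (Q x)] `&`
  [set x | forall (i : 'I_m) (j : 'I_n) (_ : i != j :> nat), D x i j = 0] `&`
  [set x | forall (i : 'I_m) (j : 'I_n), 0 <= D x i j] `&`
  [set x | forall (i i' : 'I_m) (j j' : 'I_n) (_ : i = j :> nat)
     (_ : i' = j' :> nat) (_ : (i <= i')%N), D x i' j' <= D x i j]); last first.
  apply/seteqP; split => x /=.
    by case=> -[oP oQ _] [/is_diag_mxP Ddiag Dge0 Dmono].
  case=> -[[[oP oQ] Ddiag] Dge0] Dmono.
  by split; split => //; apply/is_diag_mxP.
apply: closedI; [apply: closedI; [apply: closedI; [apply: closedI|]|]|].
- exact: closed_orthogonal.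
- exact: closed_orthogonal.
- do 3 (apply: closed_forall => ?); apply: closed_eq_fun; exact: continuous_entry.
- do 2 (apply: closed_forall => ?); apply: closed_le_fun.
    by move=> x; exact: cvg_cst.
  exact: continuous_entry.
- do 7 (apply: closed_forall => ?); apply: closed_le_fun; exact: continuous_entry.
Qed.

Lemma closed_first_cols (R : realType) (T : topologicalType) (r n : nat)
    (hrn : (r <= n)%N) (P : T -> 'M[R]_n) (b : R) :
  continuous P -> closed [set x | forall i : 'I_n,
    l2_norm ((first_cols hrn (P x))^T *m delta_mx i 0) <= b].
Proof.
move=> cP; apply: closed_forall => i; apply: closed_le_fun; last first.
  by move=> x; exact: cvg_cst.
apply: continuous_l2_norm; apply: continuous_mulmx; last first.
  by move=> x; exact: cvg_cst.
by apply: continuous_trmx; apply: continuous_colsub.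
Qed.

(** Converse direction to [svd_entry_eq0]: [D] is fixed by the projection [pid_mx r] onto the first
    $r$ rows, which has rank $r$. *)
Lemma mxrank_svd_le (F : fieldType) (m n r : nat) (P : 'M[F]_m)
    (D : 'M[F]_(m, n)) (Q : 'M[F]_n) :
  (r <= m)%N -> (forall (i : 'I_m) (j : 'I_n), (r <= i)%N -> D i j = 0) ->
  (\rank (P *m D *m Q^T) <= r)%N.
Proof.
move=> rm D0; apply: leq_trans (mxrankM_maxl _ _) _.
apply: leq_trans (mxrankM_maxr _ _) _.
suff -> : D = (pid_mx r : 'M[F]_m) *m D.
  by apply: leq_trans (mxrankM_maxl _ _) _; rewrite rank_pid_mx.
apply/matrixP => i j; rewrite mxE (bigD1 i)//= mxE eqxx/=.
rewrite big1 ?addr0 => [|k ki]; last first.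
  by rewrite mxE eq_sym [_ == _](negbTE ki) mul0r.
by case: ltnP => [_|/D0->]; rewrite ?mul1r ?mul0r.
Qed.

(** * Parametrisation of [LS] by factorisations and sparse parts *)

Notation svd_sparse R m n :=
  ('M[R]_m * 'M[R]_(m, n) * 'M[R]_n * 'M[R]_(m, n))%type.

(* x = (P, D, Q, S). The vanishing of D from row r on stands for the bound on the
   rank of P D Q^T and, unlike it, is visibly a closed condition. *)
Definition LS_data (R : realType) (m n r s : nat) (hrm : (r <= m)%N)
    (hrn : (r <= n)%N) (mu : R) :
    set (svd_sparse R m n) :=
  [set x : svd_sparse R m n |
     is_svd (x.1.1.1 *m x.1.1.2 *m x.1.2^T) x.1.1.1 x.1.1.2 x.1.2] `&`
  [set x : svd_sparse R m n |
     forall (i : 'I_m) (j : 'I_n) (_ : (r <= i)%N), x.1.1.2 i j = 0] `&`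
  [set x : svd_sparse R m n | forall i : 'I_m,
     l2_norm ((first_cols hrm x.1.1.1)^T *m delta_mx i 0)
       <= Num.sqrt (mu * r%:R / m%:R)] `&`
  [set x : svd_sparse R m n | forall i : 'I_n,
     l2_norm ((first_cols hrn x.1.2)^T *m delta_mx i 0)
       <= Num.sqrt (mu * r%:R / n%:R)] `&`
  [set x : svd_sparse R m n | (nnz x.2 <= s)%N].

Definition LS_sum (R : realType) (m n : nat)
    (x : svd_sparse R m n) : 'M[R]_(m, n) :=
  x.1.1.1 *m x.1.1.2 *m x.1.2^T + x.2.

Section projections.
Variables (R : realType) (m n : nat).
Let T := svd_sparse R m n.

Lemma continuous_left_factor : continuous (fun x : T => x.1.1.1).
Proof.
by move=> x; apply: (cvg_comp _ _ (cvg_comp _ _ cvg_fst cvg_fst) cvg_fst).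
Qed.

Lemma continuous_middle_factor : continuous (fun x : T => x.1.1.2).
Proof.
by move=> x; apply: (cvg_comp _ _ (cvg_comp _ _ cvg_fst cvg_fst) cvg_snd).
Qed.

Lemma continuous_right_factor : continuous (fun x : T => x.1.2).
Proof. by move=> x; apply: (cvg_comp _ _ cvg_fst cvg_snd). Qed.

Lemma continuous_sparse_part : continuous (fun x : T => x.2).
Proof. by move=> x; exact: cvg_snd. Qed.

Lemma continuous_LS_sum : continuous (@LS_sum R m n).
Proof.
have c1 := continuous_left_factor; have c2 := continuous_middle_factor.
have c3 := continuous_right_factor; have c4 := continuous_sparse_part.
have cL : continuous (fun x : T => x.1.1.1 *m x.1.1.2 *m x.1.2^T).
  by do 2?apply: continuous_mulmx => //; exact: continuous_trmx.
by move=> x; apply: cvgD; [exact: cL|exact: c4].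
Qed.

End projections.

Lemma closed_LS_data (R : realType) (m n r s : nat) (hrm : (r <= m)%N)
    (hrn : (r <= n)%N) (mu : R) : closed (LS_data s hrm hrn mu).
Proof.
have c1 := @continuous_left_factor R m n; have c2 := @continuous_middle_factor R m n.
have c3 := @continuous_right_factor R m n; have c4 := @continuous_sparse_part R m n.
apply: closedI; [apply: closedI; [apply: closedI; [apply: closedI|]|]|].
- exact: closed_svd.
- do 3 (apply: closed_forall => ?); apply: closed_eq_fun; exact: continuous_entry.
- exact: closed_first_cols.
- exact: closed_first_cols.
- apply: (@preimage_closed _ _ _ [set S : 'M[R]_(m, n) | (nnz S <= s)%N]).
    by move=> x _; exact: c4.
  exact: closed_nnz.
Qed.

Lemma LS_sum_data (R : realType) (m n r s : nat) (hrm : (r <= m)%N)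
    (hrn : (r <= n)%N) (mu : R) x :
  LS_data s hrm hrn mu x -> LS s hrm hrn mu (LS_sum x).
Proof.
case: x => -[[P D] Q] S [] [] [] [] /= svdL D0 UP VQ nS.
exists (P *m D *m Q^T), S; split => //; split => //.
  exact: mxrank_svd_le.
by exists P, D, Q.
Qed.

(** Bounded components have bounded parameters: orthogonal factors have entries at most $1$ in
    absolute value, and $\|D\|_F = \|L\|_F$. This confines the parameters to a compact box. *)
Lemma LS_components_data (R : realType) (m n r s : nat) (hrm : (r <= m)%N)
    (hrn : (r <= n)%N) (mu : R) (L S : 'M[R]_(m, n)) (c : R) :
  LS_components s hrm hrn mu L S -> frob_norm L <= c -> frob_norm S <= c ->
  exists2 x, LS_data s hrm hrn mu x /\ LS_sum x = L + S &
    [/\ forall i j, `|x.1.1.1 i j| <= 1, forall i j, `|x.1.1.2 i j| <= c,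
        forall i j, `|x.1.2 i j| <= 1 & forall i j, `|x.2 i j| <= c].
Proof.
move=> [rL nS [P [D [Q [svdL UP VQ]]]]] Lc Sc.
have D0 := svd_entry_eq0 svdL rL.
have [[oP oQ LE] _] := svdL.
exists (P, D, Q, S).
  by split; [do 4 split => //=; rewrite -LE|rewrite LE].
split=> i j /=.
- exact: orthogonal_entry_le1.
- apply: le_trans (entry_le_frob _ _ _) _.
  by rewrite -(frob_norm_orthogonal D oP oQ) -LE.
- exact: orthogonal_entry_le1.
- exact: le_trans (entry_le_frob _ _ _) _.
Qed.

(** Here [k] stands for the constant of (2). Such a bound prevents [L] and [S] from growing without
    limit while cancelling in their sum. *)
Lemma closed_LS (R : realType) (m n r s : nat) (hrm : (r <= m)%N)
    (hrn : (r <= n)%N) (mu k : R) :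
  0 <= k ->
  (forall L S : 'M[R]_(m, n), LS_components s hrm hrn mu L S ->
     frob_norm L <= k * frob_norm (L + S) /\
     frob_norm S <= k * frob_norm (L + S)) ->
  closed (LS s hrm hrn mu : set 'M[R]_(m, n)).
Proof.
move=> k0 LSk X clX.
(* Elements of [LS] with norm below $\|X\|_F + 1$, a condition that holds near [X], have components
   of norm at most [c]. *)
pose c := k * (frob_norm X + 1).
pose box p q b := [set A : 'M[R]_(p, q) | forall i j, `|A i j| <= b].
pose K := (box m m 1 `*` box m n c `*` box n n 1 `*` box m n c)
  `&` LS_data s hrm hrn mu.
have compactK : compact K.
  apply: compact_closedI; last exact: closed_LS_data.
  by do 3?apply: compact_setX; exact: compact_mx_box.
have closedK : closed (@LS_sum R m n @` K).
  apply: compact_closed; first exact: norm_hausdorff.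
  apply: continuous_compact => //; apply: continuous_subspaceT.
  exact: continuous_LS_sum.
have [x [_ xD] <-] : (@LS_sum R m n @` K) X; last exact: LS_sum_data.
(* As the image is closed, it suffices that it meets every neighbourhood [B] of [X]; the common
   point is an element of [LS] in [B] with norm below $\|X\|_F + 1$. *)
apply: closedK => B BX.
have Xc : \forall Y \near X, frob_norm Y < frob_norm X + 1.
  apply: (@continuous_frob_norm R m n X [set y | y < frob_norm X + 1]).
  by apply: lt_nbhsl; rewrite ltrDl.
have [Y [[L [S [LSY ->]]] [BY Yc]]] := clX _ (filterI BX Xc).
exists (L + S); split => //.
have [Lk Sk] := LSk _ _ LSY.
have kc : k * frob_norm (L + S) <= c by rewrite ler_wpM2l// ltW.
have [x [xd <-] [b1 b2 b3 b4]] :=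
  LS_components_data LSY (le_trans Lk kc) (le_trans Sk kc).
by exists x.
Qed.

(* With s = 0 the bound sqrt(mn) / (r sqrt s) is +oo, hence the guard 0 < s. *)
Theorem lemma1p1 (R : realType) (m n r s : nat) (mu : R)
    (hr : (0 < r)%N) (hrm : (r <= m)%N) (hrn : (r <= n)%N)
    (hmu1 : 1 <= mu) (hmur : mu <= Num.sqrt ((m * n)%:R) / r%:R)
    (hmu : (0 < s)%N ->
       mu < Num.sqrt ((m * n)%:R) / (r%:R * Num.sqrt s%:R)) :
  (forall X L S : 'M[R]_(m, n),
     LS_components s hrm hrn mu L S -> X = L + S ->
     [/\ `|inner_prod L S| <=
           mu * (r%:R * Num.sqrt s%:R / Num.sqrt ((m * n)%:R))
              * frob_norm L * frob_norm S,
         frob_norm L <=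
           (1 - mu ^+ 2 * (r%:R ^+ 2 * s%:R / (m * n)%:R)) `^ (- (1 / 2))
              * frob_norm X &
         frob_norm S <=
           (1 - mu ^+ 2 * (r%:R ^+ 2 * s%:R / (m * n)%:R)) `^ (- (1 / 2))
              * frob_norm X])
  /\ closed (LS s hrm hrn mu).
Proof.
have mn0 : 0 < (m * n)%:R :> R.
  by rewrite ltr0n muln_gt0 (leq_trans hr hrm) (leq_trans hr hrn).
have mu0 : 0 <= mu := le_trans ler01 hmu1.
(* The factor in (1). For $s > 0$ the strict bound on [mu] amounts to $g < 1$. *)
pose g := mu * (r%:R * Num.sqrt s%:R / Num.sqrt ((m * n)%:R)).
have g0 : 0 <= g.
  by rewrite mulr_ge0// divr_ge0 ?sqrtr_ge0// mulr_ge0 ?sqrtr_ge0 ?ler0n.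
have gg : g ^+ 2 = mu ^+ 2 * (r%:R ^+ 2 * s%:R / (m * n)%:R).
  by rewrite !exprMn exprVn !sqr_sqrtr ?ler0n.
have g1 : g ^+ 2 < 1.
  (* For $s = 0$ the guarded bound says nothing, but then $g = 0$. *)
  have [s0|s0] := posnP s; first by rewrite gg s0 mulr0 mul0r mulr0.
  rewrite expr_lt1// /g mulrA ltr_pdivrMr ?sqrtr_gt0// mul1r.
  by rewrite -ltr_pdivlMr ?hmu// mulr_gt0 ?sqrtr_gt0 ?ltr0n.
have ip_le (L S : 'M[R]_(m, n)) : LS_components s hrm hrn mu L S ->
    `|inner_prod L S| <= g * frob_norm L * frob_norm S.
  move=> LSLS; rewrite -(@ler_pXn2r _ 2) ?nnegrE ?mulr_ge0 ?frob_norm_ge0//.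
  rewrite real_normK ?num_real// 2!exprMn gg.
  exact: inner_prod_incoherent_sparse LSLS.
have norm_le (L S : 'M[R]_(m, n)) : LS_components s hrm hrn mu L S ->
    frob_norm L <= (1 - g ^+ 2) `^ (- (1 / 2)) * frob_norm (L + S) /\
    frob_norm S <= (1 - g ^+ 2) `^ (- (1 / 2)) * frob_norm (L + S).
  move=> /ip_le LS_le; split; first exact: frob_norm_decomposition_le.
  rewrite [L + S]addrC; apply: frob_norm_decomposition_le => //.
  by rewrite inner_prodC mulrAC.
split; last exact: closed_LS (powR_ge0 _ _) norm_le.
move=> X L S LSLS ->; have [Lle Sle] := norm_le _ _ LSLS.
by rewrite -gg; split => //; exact: ip_le.
Qed.
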